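(* Let $w(x,y,t)=x^2+y^2+4t$. For every $j\geq0$, the linear map $$A_j:P_j(\mathbb H)\longrightarrow P_j(\mathbb H),\qquad A_jq=\Delta_H(wq),$$ is an automorphism (a linear bijection).
   Context: $\mathbb H=\mathbb C\times\mathbb R$ is the first Heisenberg group, $z=x+iy$, with coordinates $(x,y,t)$. The horizontal fields are $X=\partial_x+2y\partial_t$, $Y=\partial_y-2x\partial_t$, and the sub-Laplacian is $\Delta_H=X^2+Y^2$. Dilations are $\delta_r(z,t)=(rz,r^2t)$. $P_j(\mathbb H)$ is the space of polynomials $p$ in $(x,y,t)$ with complex coefficients such that $p\circ\delta_r=r^jp$ for every $r>0$. *)

(* Defs.v *)
From HB Require Import structures.
From mathcomp Require Import all_boot all_order all_algebra.
From mathcomp Require Import boolp reals complex mpoly.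

Set Implicit Arguments.
Unset Strict Implicit.
Unset Printing Implicit Defensive.

Import GRing.Theory Num.Theory.

Local Open Scope ring_scope.
Local Open Scope complex_scope.


(* The coordinates (x, y, t) of the Heisenberg group are the variables 0, 1, 2.
   Polynomials are formal, and R[i] is the field of complex numbers. *)
Definition ix : 'I_3 := @Ordinal 3 0 isT.
Definition iy : 'I_3 := @Ordinal 3 1 isT.
Definition it : 'I_3 := @Ordinal 3 2 isT.

Definition cx (R : realType) : {mpoly R[i][3]} := 'X_ix.
Definition cy (R : realType) : {mpoly R[i][3]} := 'X_iy.
Definition ct (R : realType) : {mpoly R[i][3]} := 'X_it.

Definition fieldX (R : realType) (p : {mpoly R[i][3]}) : {mpoly R[i][3]} :=
  p^`M(ix) + 2%:R * cy R * p^`M(it).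

Definition fieldY (R : realType) (p : {mpoly R[i][3]}) : {mpoly R[i][3]} :=
  p^`M(iy) - 2%:R * cx R * p^`M(it).

Definition sub_laplacian (R : realType) (p : {mpoly R[i][3]}) :
    {mpoly R[i][3]} :=
  fieldX (fieldX p) + fieldY (fieldY p).

(* The coordinates of the dilation (x, y, t) |-> (r x, r y, r^2 t), so that
   [p \mPo dilation r] is the composite of p with this dilation. *)
Definition dilation (R : realType) (r : R) : 3.-tuple {mpoly R[i][3]} :=
  [tuple r%:C *: cx R; r%:C *: cy R; (r ^+ 2)%:C *: ct R].

Definition is_hhomog (R : realType) (j : nat) (p : {mpoly R[i][3]}) : Prop :=
  forall r : R, 0 < r -> p \mPo dilation r = (r ^+ j)%:C *: p.

Definition hhomog_pred (R : realType) (j : nat) : {pred {mpoly R[i][3]}} :=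
  fun p => `[< is_hhomog j p >].

Fact hhomog_submod_closed (R : realType) (j : nat) :
  submod_closed (@hhomog_pred R j).
Proof.
split=> [|a p q /asboolP hp /asboolP hq]; apply/asboolP => r r0.
  by rewrite comp_mpoly0 scaler0.
by rewrite comp_mpolyD comp_mpolyZ hp // hq // scalerDr !scalerA mulrC.
Qed.

HB.instance Definition _ (R : realType) (j : nat) :=
  GRing.isSubmodClosed.Build R[i] {mpoly R[i][3]} (@hhomog_pred R j)
    (@hhomog_submod_closed R j).

(* P_j(H), as a vector space over R[i]. *)
Record hhomog (R : realType) (j : nat) : Type :=
  HHomog { hhomog_val :> {mpoly R[i][3]}; _ : hhomog_val \in @hhomog_pred R j }.

HB.instance Definition _ (R : realType) (j : nat) :=
  [isSub of hhomog R j for @hhomog_val R j].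
HB.instance Definition _ (R : realType) (j : nat) :=
  [Choice of hhomog R j by <:].
HB.instance Definition _ (R : realType) (j : nat) :=
  [SubChoice_isSubLmodule of hhomog R j by <:].

Definition wpoly (R : realType) : {mpoly R[i][3]} :=
  cx R ^+ 2 + cy R ^+ 2 + 4%:R * ct R.

(* Main.v *)
Require Import Defs.
From HB Require Import structures.
From mathcomp Require Import all_boot all_order all_algebra.
From mathcomp Require Import boolp reals complex mpoly.
From mathcomp Require Import zify ring.

(** Write D for the sub-Laplacian. The space P_j is finite-dimensional and
    stable under q |-> D (w q), because w has degree 2 and D lowers degrees by
    2 for the dilations ([heis_lap_w_homog]); so it is enough to prove
    injectivity ([inj_endo_surj]).

    Injectivity holds on all polynomials ([heis_lap_w_inj]). In coordinates z,
    zb the operator D commutes with the rotations of z, so it acts separately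
    on the polynomials z^m f(rho, t) and zb^m f(rho, t), rho = z zb, with f
    homogeneous of degree n in (rho, t). On each of these spaces D is a
    second-order operator L whose kernel is a line: the coefficients of f
    satisfy a three-term recurrence that determines them from the first one
    ([profile_rec_uniq]). If D (w q) = 0, the component f of w q is in this
    kernel and vanishes where w does, in particular at (rho, t) = (-4, 1). So
    the point is that the generator of the kernel does not vanish there
    ([profile_boundary_zero]).

    For m > 0 the generator is the sum over p + q = n of (m + 1/2)_p (1/2)_q /
    (p! q!) u^p v^q with u = t + i rho, v = t - i rho (and i replaced by - i
    for zb^m), since L is an Euler-Poisson-Darboux operator in u and v
    ([profile_op_profile]). The coefficients increase with p, and u / v is a
    point of the unit circle other than 1, so the Enestrom-Kakeya argument
    shows that the sum is nonzero ([profile_boundary_neq0]).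

    For m = 0 the coefficients are symmetric and this argument fails, but the
    generator is then the sum over l of C(n, 2l) C(2l, l) (- 1/4)^l rho^(2l)
    t^(n-2l), whose value at (-4, 1) is an integer congruent to 1 modulo 4
    ([radial_profile_boundary_neq0]). This is where the constant 4 in w
    matters: for other constants a Legendre polynomial may vanish. *)

Set Implicit Arguments.
Unset Strict Implicit.
Unset Printing Implicit Defensive.

Import Order.TTheory GRing.Theory Num.Theory.

Local Open Scope ring_scope.
Local Open Scope complex_scope.

(** * The three-term recurrence and its differential equation *)

Section Recurrence.
Variables (C : numClosedFieldType) (eps : C) (m n : nat).

(** With rho = z zb, and up to rescaling the coordinates, the operator L f =
    rho f_rr + (m+1) f_r - eps^2 rho f_tt - eps m f_t (subscript r for rho) is
    the sub-Laplacian on the functions z^m f(rho, t) when eps = i, and on zb^m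
    f(rho, t) when eps = - i. For f = sum_i g i rho^i t^(n-i), the recurrence
    is the vanishing of the coefficient of rho^i t^(n-1-i) in L f. The factor
    - eps^2 stands for 1: it makes the identities below hold for every eps. *)
Definition profile_rec (g : nat -> C) : Prop :=
  forall i, (i < n)%N ->
    i.+1%:R * (i.+1%:R + m%:R) * g i.+1 - eps * m%:R * (n%:R - i%:R) * g i
    - eps ^+ 2 * (if i is j.+1
                  then (n%:R - j%:R) * (n%:R - j%:R - 1) * g j else 0) = 0.

(** The coefficient of [g i.+1] is nonzero, so a solution is determined up to
    scaling by its value at 0; the statement avoids dividing by that value. *)
Lemma profile_rec_uniq (g1 g2 : nat -> C) :
    profile_rec g1 -> profile_rec g2 ->
  forall i, (i <= n)%N -> g1 i * g2 0%N = g2 i * g1 0%N.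
Proof.
move=> rec1 rec2 i; elim/ltn_ind: i => -[|i] IH lein; first exact: mulrC.
have c_neq0 : i.+1%:R * (i.+1%:R + m%:R) != 0 :> C.
  by rewrite -natrD -natrM pnatr_eq0.
have := rec1 _ lein; have := rec2 _ lein.
have IHi := IH i (leqnn _) (ltnW lein).
case: i lein IH IHi c_neq0 => [|j] lein IH IHi c_neq0 r2 r1;
  apply: (mulfI c_neq0); apply/eqP; rewrite -subr_eq0.
  set c := _ * (_ + _).
  set d := eps * m%:R * (n%:R - 0%:R).
  have -> : c * (g1 1%N * g2 0%N) - c * (g2 1%N * g1 0%N) =
    (c * g1 1%N - d * g1 0%N - eps ^+ 2 * 0) * g2 0%N -
    (c * g2 1%N - d * g2 0%N - eps ^+ 2 * 0) * g1 0%N by ring.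
  by rewrite r1 r2 !mul0r subrr.
have IHj := IH j (leqW (leqnn _)) (ltnW (ltnW lein)).
move: r1 r2; set c := _ * (_ + m%:R); set d := eps * _ * _.
set e := (n%:R - j%:R) * _ => r1 r2.
have -> : c * (g1 j.+2 * g2 0%N) - c * (g2 j.+2 * g1 0%N) =
    (c * g1 j.+2 - d * g1 j.+1 - eps ^+ 2 * (e * g1 j)) * g2 0%N -
    (c * g2 j.+2 - d * g2 j.+1 - eps ^+ 2 * (e * g2 j)) * g1 0%N
    + d * (g1 j.+1 * g2 0%N - g2 j.+1 * g1 0%N)
    + eps ^+ 2 * e * (g1 j * g2 0%N - g2 j * g1 0%N) by ring.
by rewrite r1 r2 IHi IHj !mul0r !subrr !mulr0 !addr0.
Qed.

(** L applied to f = t^n G(rho / t), written at t = 1 by means of Euler's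
    relation t f_t = n f - rho f_r. *)
Definition profile_op (G : {poly C}) : {poly C} :=
  'X * (1 - eps%:P ^+ 2 * 'X ^+ 2) * G^`()^`()
  + (m.+1%:R + eps%:P * m%:R * 'X + 2%:R * eps%:P ^+ 2 * (n%:R - 1) * 'X ^+ 2)
     * G^`()
  - (eps%:P * m%:R * n%:R + eps%:P ^+ 2 * n%:R * (n%:R - 1) * 'X) * G.

Lemma profile_op_rec (G : {poly C}) :
  profile_op G = 0 -> profile_rec (fun i => G`_i).
Proof.
move=> DG0 i ltin.
have : (profile_op G)`_i = 0 by rewrite DG0 coef0.
have -> : profile_op G =
  'X * G^`()^`() - (eps ^+ 2)%:P * ('X * ('X * ('X * G^`()^`())))
  + m.+1%:R%:P * G^`() + (eps * m%:R)%:P * ('X * G^`())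
  + (2%:R * eps ^+ 2 * (n%:R - 1))%:P * ('X * ('X * G^`()))
  - (eps * m%:R * n%:R)%:P * G - (eps ^+ 2 * n%:R * (n%:R - 1))%:P * ('X * G).
  rewrite /profile_op; ring.
have derE (p : {poly C}) k : p^`()`_k = (k%:R + 1) * p`_k.+1.
  by rewrite coef_deriv mulrDl mul1r mulr_natl -mulrSr.
have natS k : k.+1%:R = k%:R + 1 :> C by rewrite mulrSr.
rewrite !(coefD, coefN, coefCM, coefXM).
case: i ltin => [|[|[|i]]] ltin; rewrite /= ?derE => DGi;
  apply: etrans DGi; rewrite ?natS.
all: ring.
Qed.

Lemma profile_op_sum I (r : seq I) (c : I -> C) (F : I -> {poly C}) :
  profile_op (\sum_(i <- r) (c i)%:P * F i) =
  \sum_(i <- r) (c i)%:P * profile_op (F i).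
Proof.
elim: r => [|i r IH].
  by rewrite !big_nil /profile_op !deriv0; ring.
rewrite !big_cons -IH /profile_op !derivD !derivM !derivC !derivD !derivM.
rewrite !derivC; ring.
Qed.

Let u : {poly C} := 1 + eps%:P * 'X.
Let v : {poly C} := 1 - eps%:P * 'X.

(** In the variables u = t + eps rho, v = t - eps rho, L becomes
    - 2 eps ((u - v) f_uv - f_u / 2 + (m + 1/2) f_v), an Euler-Poisson-Darboux
    operator, which sends u^p v^q to a combination of u^p v^(q-1) and
    u^(p-1) v^q.  Multiplying by u v avoids the exponents p - 1 and q - 1. *)
Lemma profile_op_monomial p q : (p + q)%N = n ->
  u * v * profile_op (u ^+ p * v ^+ q) =
  - eps%:P * (q%:R * (p%:R *+ 2 + m%:R *+ 2 + 1) * u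
             - p%:R * (q%:R *+ 2 + 1) * v) * (u ^+ p * v ^+ q).
Proof.
move=> pqn.
have du : u^`() = eps%:P.
  by rewrite /u derivD derivM !derivC derivX; ring.
have dv : v^`() = - eps%:P.
  by rewrite /v derivB derivM !derivC derivX; ring.
have dexp (a : {poly C}) k : a * (a ^+ k)^`() = k%:R * a^`() * a ^+ k.
  case: k => [|k]; first by rewrite expr0 derivC mulr0 !mul0r.
  by rewrite deriv_exp /= exprS -mulr_natr; ring.
set T := u ^+ p * v ^+ q.
(* Both derivatives of T are rational multiples of T with denominators u v,
   so the claim is a combination of the next two identities. *)
have T1 : u * v * T^`() = eps%:P * (p%:R * v - q%:R * u) * T.
  have -> : u * v * T^`() =
      v * v ^+ q * (u * (u ^+ p)^`()) + u * u ^+ p * (v * (v ^+ q)^`()).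
    by rewrite /T derivM; ring.
  by rewrite !dexp du dv /T; ring.
clearbody T.
have T2 : u * v * T^`()^`() = - eps%:P ^+ 2 * (p%:R + q%:R) * T
    + (eps%:P * (p%:R * v - q%:R * u) + 2%:R * eps%:P ^+ 2 * 'X) * T^`().
  have := congr1 (@deriv C) T1.
  rewrite !derivM !derivB !derivM !derivC -!polyC_natr !derivC du dv.
  rewrite ?derivX !polyC_natr => eqT.
  apply/eqP; rewrite -subr_eq0.
  have := eqT; move/eqP; rewrite -subr_eq0 => /eqP <-; apply/eqP.
  rewrite /u /v; ring.
apply/eqP; rewrite -subr_eq0.
move/eqP: T1; rewrite -subr_eq0; set A := (X in X == 0) => /eqP T1.
move/eqP: T2; rewrite -subr_eq0; set B := (X in X == 0) => /eqP T2.
suff -> : u * v * profile_op T - - eps%:P *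
    (q%:R * (p%:R *+ 2 + m%:R *+ 2 + 1) * u - p%:R * (q%:R *+ 2 + 1) * v) * T
  = 'X * (1 - eps%:P ^+ 2 * 'X ^+ 2) * B
    + (m.+1%:R + eps%:P * m%:R * 'X + 2%:R * eps%:P ^+ 2 * (n%:R - 1) * 'X ^+ 2
    + 'X * (eps%:P * (p%:R * v - q%:R * u) + 2%:R * eps%:P ^+ 2 * 'X)) * A.
  by rewrite T1 T2 !mulr0 addr0.
rewrite /A /B /profile_op -pqn /u /v.
ring.
Qed.

End Recurrence.

(** * Polynomials with increasing coefficients *)

(** The theorem of Enestrom and Kakeya on the unit circle.  Multiplying by 1 - x
    turns a zero into the equality a_n x^(n+1) = sum of d_p x^p, where the d_p,
    differences of consecutive coefficients, are positive and add up to a_n.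
    This is the equality case of the triangle inequality, so all x^p have the
    same direction; p = 0 and p = 1 give x = 1. *)
Lemma sum_increasing_coef_neq0 (C : numClosedFieldType) (a : nat -> C) n x :
    (0 < n)%N -> 0 < a 0%N -> (forall p, (p < n)%N -> a p < a p.+1) ->
  `|x| = 1 -> x != 1 -> \sum_(p < n.+1) a p * x ^+ p != 0.
Proof.
move=> n_gt0 a0_gt0 a_incr x1 x_neq1; apply/eqP => S0.
pose d p := if p is k.+1 then a p - a k else a 0%N.
have sumd y k : \sum_(p < k.+1) d p * y ^+ p =
    (1 - y) * (\sum_(p < k.+1) a p * y ^+ p) + a k * y ^+ k.+1.
  elim: k => [|k IH]; first by rewrite !big_ord_recr !big_ord0 /= expr0; ring.
  by rewrite big_ord_recr /= IH [in RHS]big_ord_recr /= !exprS; ring.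
have d_gt0 (p : 'I_n.+1) : 0 < d p.
  by case: p => -[|p] ltp //=; rewrite subr_gt0 a_incr.
have normd (p : 'I_n.+1) : `|d p * x ^+ p| = d p.
  by rewrite normrM normrX x1 expr1n mulr1 ger0_norm // ltW.
have an_ge0 : 0 <= a n.
  have := sumd 1 n; rewrite subrr mul0r add0r expr1n mulr1 => <-.
  by apply: sumr_ge0 => p _; rewrite expr1n mulr1 ltW.
have [|t _ ht] := @normC_sum_eq C 'I_n.+1 xpredT (fun p => d p * x ^+ p).
  rewrite sumd S0 mulr0 add0r normrM normrX x1 expr1n mulr1 ger0_norm //.
  have := sumd 1 n; rewrite subrr mul0r add0r expr1n mulr1 => <-.
  by apply: eq_bigr => p _; rewrite normd expr1n mulr1.
have t1 : t = 1.
  have /= := ht ord0 isT; rewrite expr0 mulr1 gtr0_norm // => h.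
  by apply: (mulfI (lt0r_neq0 a0_gt0)); rewrite mulr1 -h.
have := ht (Ordinal (n_gt0 : 1 < n.+1)%N) isT.
rewrite normd t1 expr1 => h; case/eqP: x_neq1.
exact: (mulfI (lt0r_neq0 (d_gt0 (Ordinal (n_gt0 : 1 < n.+1)%N)))).
Qed.

(** * An explicit solution *)

Section Explicit.
Variables (C : numClosedFieldType) (m n : nat).

(** (m + 1/2)_p (1/2)_(n-p) / (p! (n-p)!), normalised to be 1 at p = 0. *)
Fixpoint weight p : C :=
  if p is k.+1 then
    weight k * ((n%:R - k%:R) * (k%:R *+ 2 + m%:R *+ 2 + 1))
    / (k.+1%:R * ((n%:R - k%:R) *+ 2 - 1))
  else 1.

Lemma weight_rec p : (p <= n)%N ->
  weight p.+1 * (p.+1%:R * ((n%:R - p%:R) *+ 2 - 1)) =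
  weight p * ((n%:R - p%:R) * (p%:R *+ 2 + m%:R *+ 2 + 1)).
Proof.
move=> lepn; rewrite /= mulfVK // mulf_neq0 ?pnatr_eq0 // -natrB //.
rewrite -mulr_natr -natrM subr_eq0 (eqr_nat _ _ 1).
by apply/negP => /eqP h; move: (congr1 odd h); rewrite oddM andbF.
Qed.

(** This closes the telescoping sum in [profile_op_profile]. *)
Lemma weight_last : weight n.+1 = 0.
Proof. by rewrite /= subrr !(mul0r, mulr0). Qed.

(** Comparing the two sides of [weight_rec] gives
    (n - p)(2p + 2m + 1) > (p + 1)(2(n - p) - 1) as soon as m > 0.  For m = 0
    the weights are symmetric in p and n - p, hence not increasing. *)
Lemma weight_step p : (p < n)%N -> 0 < weight p ->
  0 < weight p.+1 /\ ((0 < m)%N -> weight p < weight p.+1).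
Proof.
move=> ltpn w_gt0; have := weight_rec (ltnW ltpn).
have -> : (n%:R - p%:R) *+ 2 - 1 = ((n - p).*2 - 1)%:R :> C.
  by rewrite natrB ?double_gt0 ?subn_gt0 // -mul2n natrM natrB ?(ltnW ltpn) //
    mulr_natl.
have -> : (n%:R - p%:R) * (p%:R *+ 2 + m%:R *+ 2 + 1) =
    ((n - p) * (p.*2 + m.*2 + 1))%:R :> C.
  rewrite natrM natrB ?(ltnW ltpn) // !natrD -!mul2n !natrM; ring.
rewrite -natrM; set b := (p.+1 * _)%N; set c := (_ * (_ + _ + 1))%N => eqw.
have b_gt0 : 0 < b%:R :> C by rewrite ltr0n /b muln_gt0 /=; lia.
have c_gt0 : 0 < c%:R :> C by rewrite ltr0n /c muln_gt0; lia.
split; first by rewrite -(pmulr_lgt0 _ b_gt0) eqw mulr_gt0.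
move=> m_gt0; rewrite -(ltr_pM2r b_gt0) eqw ltr_pM2l // ltr_nat /b /c.
move: (n - p)%N (subn_gt0 p n) => q.
by rewrite ltpn {b c eqw b_gt0 c_gt0} => q_gt0; nia.
Qed.

Lemma weight_gt0 p : (p <= n)%N -> 0 < weight p.
Proof.
elim: p => [|p IH] lepn; first exact: ltr01.
by have [] := weight_step lepn (IH (ltnW lepn)).
Qed.

Lemma weight_incr p : (0 < m)%N -> (p < n)%N -> weight p < weight p.+1.
Proof.
by move=> m0 lt; have [_ ->] := weight_step lt (weight_gt0 (ltnW lt)).
Qed.

Variable eps : C.
Let u : {poly C} := 1 + eps%:P * 'X.
Let v : {poly C} := 1 - eps%:P * 'X.

(** The degree n part of (1 - u)^(- m - 1/2) (1 - v)^(- 1/2), up to a scalar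
    and at t = 1. *)
Definition profile : {poly C} :=
  \sum_(p < n.+1) (weight p)%:P * (u ^+ p * v ^+ (n - p)).

Lemma profile_at s :
  profile.[s] = \sum_(p < n.+1) weight p * (1 + eps * s) ^+ p
                                         * (1 - eps * s) ^+ (n - p).
Proof.
rewrite horner_sum; apply: eq_bigr => p _.
by rewrite /u /v !hornerE.
Qed.

Lemma profile_op_profile : profile_op eps m n profile = 0.
Proof.
have nz1 e : (1 + e%:P * 'X : {poly C}) != 0.
  by apply/eqP => /(congr1 (horner^~ 0)) /eqP; rewrite !hornerE oner_eq0.
have uv_neq0 : u * v != 0.
  apply: mulf_neq0; first exact: nz1.
  by have := nz1 (- eps); rewrite polyCN mulNr.
apply: (mulfI uv_neq0); rewrite mulr0 profile_op_sum mulr_sumr.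
(* By [profile_op_monomial] each term is a difference of consecutive tau. *)
pose tau p : {poly C} := (weight p)%:P *
  (p%:R * ((n%:R - p%:R) *+ 2 + 1)) * u ^+ p * v ^+ (n.+1 - p).
transitivity (\sum_(0 <= p < n.+1) - eps%:P * (tau p.+1 - tau p)).
  rewrite big_mkord; apply: eq_bigr => -[p ltp] _ /=.
  rewrite mulrCA profile_op_monomial; last by lia.
  rewrite /tau subSS (subSn (ltp : p <= n)%N) natrB //.
  have := weight_rec (ltp : p <= n)%N.
  move: (weight p.+1) (weight p) => w1 w /(congr1 (@polyC C)).
  rewrite !(polyCM, polyCB, polyCD, polyCMn) !polyC1 => eqw.
  have -> : w1%:P * (p.+1%:R * ((n%:R - p.+1%:R) *+ 2 + 1)) =
    w%:P * ((n%:R - p%:R) * (p%:R *+ 2 + m%:R *+ 2 + 1)) :> {poly C}.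
    apply: etrans eqw; rewrite -natr1; ring.
  rewrite -/u -/v !exprS; ring.
rewrite -mulr_sumr telescope_sumr // /tau weight_last.
by rewrite !(mul0r, mulr0, subrr).
Qed.

End Explicit.

(** * No nonzero solution vanishes at (rho, t) = (-4, 1) *)

Section OneDim.
Variables (C : numClosedFieldType) (eps : C).
Hypothesis eps2 : eps ^+ 2 = -1.
Hypothesis norm_eps : `|1 - 4%:R * eps| = `|1 + 4%:R * eps|.

(** At s = -4 the numbers u = 1 - 4 eps and v = 1 + 4 eps are distinct and have
    the same modulus, so the sum is v^n times a polynomial with increasing
    coefficients at the point u / v of the unit circle. *)
Lemma profile_boundary_neq0 m n : (0 < m)%N -> (profile m n eps).[- 4%:R] != 0.
Proof.
move=> m_gt0; rewrite profile_at.
have eps_neq0 : eps != 0.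
  apply/eqP => e0; move/eqP: eps2.
  by rewrite e0 expr0n eq_sym oppr_eq0 oner_eq0.
set v := 1 - eps * - _; set u := 1 + eps * - _.
have uE : u = 1 - 4%:R * eps by rewrite /u; ring.
have vE : v = 1 + 4%:R * eps by rewrite /v; ring.
have v_neq0 : v != 0.
  apply/eqP => v0.
  have u0 : u = 0 by apply/eqP; rewrite -normr_eq0 uE norm_eps -vE v0 normr0.
  have : u + v = 2%:R by rewrite uE vE; ring.
  by rewrite u0 v0 addr0 => /eqP; rewrite eq_sym pnatr_eq0.
case: n => [|n].
  by rewrite big_ord_recr big_ord0 /= !expr0 add0r !mulr1 oner_eq0.
have -> : \sum_(p < n.+2) weight C m n.+1 p * u ^+ p * v ^+ (n.+1 - p) =
    v ^+ n.+1 * \sum_(p < n.+2) weight C m n.+1 p * (u / v) ^+ p.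
  rewrite mulr_sumr; apply: eq_bigr => -[p ltp] _ /=.
  have -> : v ^+ n.+1 = v ^+ (n.+1 - p) * v ^+ p.
    by rewrite -exprD subnK.
  have vp_neq0 : v ^+ p != 0 by rewrite expf_neq0.
  rewrite expr_div_n; move: (weight _ _ _ p) (u ^+ p) (v ^+ p) vp_neq0.
  by move: (v ^+ _) => a w b c c_neq0; field.
rewrite mulf_neq0 ?expf_neq0 // sum_increasing_coef_neq0 //.
- by move=> p ltp; apply: weight_incr.
- by rewrite normrM normfV uE norm_eps -vE divff ?normr_eq0.
apply/eqP => /(canRL (divfK v_neq0)); rewrite mul1r uE vE => /eqP.
rewrite -subr_eq0; have -> : 1 - 4%:R * eps - (1 + 4%:R * eps) = - (8%:R * eps).
  by ring.
by rewrite oppr_eq0 mulf_eq0 (negPf eps_neq0) pnatr_eq0.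
Qed.

(** For m = 0 the recurrence relates only indices of the same parity.  These are
    its coefficients of even index 2l; the solution is the one behind the
    Legendre polynomial of degree n. *)
Definition radial_coef n l : C :=
  (- 4%:R^-1) ^+ l * ('C(n, l.*2) * 'C(l.*2, l))%:R.

Lemma radial_coefS n l : (l.*2.+1 < n)%N ->
  l.*2.+2%:R * l.*2.+2%:R * radial_coef n l.+1 =
  - ((n%:R - l.*2%:R) * (n%:R - l.*2%:R - 1) * radial_coef n l).
Proof.
move=> ltln; rewrite /radial_coef doubleS exprS.
have e1 : (l.*2.+2 * (l.*2.+1 * 'C(n, l.*2.+2)) =
    (n - l.*2.+1) * ((n - l.*2) * 'C(n, l.*2)))%N.
  by have := mul_bin_left n l.*2; have := mul_bin_left n l.*2.+1; nia.
have e2 : (l.+1 * 'C(l.*2.+2, l.+1) = 2 * (l.*2.+1 * 'C(l.*2, l)))%N.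
  rewrite -mul_bin_diag /= [(l.*2.+1 * _)%N](mul_bin_down l.*2.+1 l) /=.
  have -> : (l.*2.+1 - l = l.+1)%N by lia.
  by rewrite mulnA -[l.*2.+2]/(l.+1).*2 mul2n.
have e3 : (l.*2.+2 * l.*2.+2 * ('C(n, l.*2.+2) * 'C(l.*2.+2, l.+1)) =
   4 * ((n - l.*2) * (n - l.*2.+1) * ('C(n, l.*2) * 'C(l.*2, l))))%N.
  nia.
have := congr1 (fun k => k%:R : C) e3.
rewrite !natrM natrB ?(ltnW (ltnW ltln)) // natrB ?(ltnW ltln) // => e4.
have f : (4%:R : C) != 0 by rewrite pnatr_eq0.
apply: (mulfI f).
rewrite -[l.*2.+1%:R]natr1 in e4.
set a := (- 4%:R^-1) ^+ l.
have -> : 4%:R * - ((n%:R - l.*2%:R) * (n%:R - l.*2%:R - 1) *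
    (a * ('C(n, l.*2)%:R * 'C(l.*2, l)%:R))) =
  - a * (4%:R * ((n%:R - l.*2%:R) * (n%:R - (l.*2%:R + 1)) *
    ('C(n, l.*2)%:R * 'C(l.*2, l)%:R))) :> C by ring.
by rewrite -e4; field.
Qed.

Definition radial_profile n i : C := if odd i then 0 else radial_coef n i./2.

Lemma radial_profile_rec n : profile_rec eps 0 n (radial_profile n).
Proof.
move=> i ltin; rewrite eps2 mulr0 !mul0r subr0 addr0 mulN1r opprK.
rewrite /radial_profile; case: i ltin => [|j] ltjn; rewrite /= ?mulr0 ?addr0 //.
case: (boolP (odd j)) => oj /=; rewrite ?mulr0 ?addr0 //.
have [l jE] : exists l, j = l.*2.
  by exists j./2; rewrite -[LHS]odd_double_half (negPf oj).
by rewrite jE in ltjn *; rewrite doubleK radial_coefS // addNr.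
Qed.

(** At rho = -4 the powers of 4 in the denominators are absorbed: the terms are
    integers, the first is 1 and the others are multiples of 4. *)
Lemma radial_profile_boundary_neq0 n :
  \sum_(i < n.+1) radial_profile n i * (- 4%:R) ^+ i != 0.
Proof.
pose z i : int := if odd i then 0 else
  (-1) ^+ i./2 * 4%:Z ^+ i./2 * ('C(n, i) * 'C(i, i./2))%:Z.
have zE i : radial_profile n i * (- 4%:R) ^+ i = (z i)%:~R.
  rewrite /radial_profile /z; case: (boolP (odd i)) => oi; rewrite ?mul0r //.
  have iE : i = i./2.*2 by rewrite -[LHS]odd_double_half (negPf oi).
  move: iE; set l := i./2 => ->; rewrite /radial_coef.
  rewrite !rmorphM !rmorphXn /= -[in (- 4%:R) ^+ _]mul2n exprM mulrAC -exprMn.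
  rewrite -exprMn -natrM; congr (_ ^+ _ * _).
  by field.
under eq_bigr do rewrite zE.
rewrite -rmorph_sum /= intr_eq0 big_ord_recl /= /z /= !expr0 !bin0 !mul1r.
have [y ->] : exists y : int, \sum_(i < n) z (bump 0 i) = 4%:Z * y.
  exists (\sum_(i < n) if odd i.+1 then 0 else
   (-1) ^+ i.+1./2 * 4%:Z ^+ i.+1./2.-1 * ('C(n, i.+1) * 'C(i.+1, i.+1./2))%:Z).
  rewrite mulr_sumr; apply: eq_bigr => i _; rewrite /z /bump /= add1n /=.
  case: (boolP (odd i)) => oi; rewrite ?mulr0 //=.
  case: (nat_of_ord i) oi => //= k _; rewrite !exprS.
  by move: (Posz (_ * _)%N) (4%:Z ^+ _) => a b; ring.
lia.
Qed.

(** By uniqueness [g] is proportional to a solution that does not vanish at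
    (-4, 1). *)
Lemma profile_boundary_zero m n (g : nat -> C) :
    profile_rec eps m n g -> \sum_(i < n.+1) g i * (- 4%:R) ^+ i = 0 ->
  forall i, (i <= n)%N -> g i = 0.
Proof.
move=> g_rec g_sum.
suff [c [c_rec c0 c_sum]] : exists c, [/\ profile_rec eps m n c, c 0%N != 0 &
    \sum_(i < n.+1) c i * (- 4%:R) ^+ i != 0].
  have gc i : (i <= n)%N -> g i * c 0%N = c i * g 0%N.
    by move=> lein; apply: profile_rec_uniq g_rec c_rec i lein.
  have g0 : g 0%N = 0.
    apply: (mulIf c_sum); rewrite mul0r mulr_sumr.
    transitivity (c 0%N * \sum_(i < n.+1) g i * (- 4%:R) ^+ i); last first.
      by rewrite g_sum mulr0.
    rewrite mulr_sumr; apply: eq_bigr => -[i lti] _ /=.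
    transitivity (c i * g 0%N * (- 4%:R) ^+ i); first by ring.
    by rewrite -gc //; ring.
  by move=> i lein; apply: (mulIf c0); rewrite gc // g0 mulr0 mul0r.
case: (posnP m) => [->|m_gt0].
  exists (radial_profile n); split.
  - exact: radial_profile_rec.
  - by rewrite /radial_profile /= /radial_coef expr0 !bin0 mul1r oner_eq0.
  - exact: radial_profile_boundary_neq0.
exists (fun i => (profile m n eps)`_i); split.
- exact/profile_op_rec/profile_op_profile.
- rewrite -horner_coef0 profile_at; apply/lt0r_neq0.
  rewrite mulr0 addr0 subr0; under eq_bigr do rewrite !expr1n !mulr1.
  rewrite big_ord_recl ltr_pwDl ?weight_gt0 //.
  by apply: sumr_ge0 => p _; rewrite ltW // weight_gt0 // -ltnS ltn_ord.
rewrite -(@horner_coef_wide _ n.+1) ?profile_boundary_neq0 //.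
apply: leq_trans (size_sum _ _ _) _; apply/bigmax_leqP => p _.
have size2 (e : C) : (size (1 + e%:P * 'X : {poly C})%R <= 2)%N.
  by rewrite addrC size_MXaddC; case: ifP => // _; rewrite ltnS size_polyC_leq1.
have sizeX (e : C) k : (size ((1 + e%:P * 'X : {poly C}) ^+ k)%R <= k.+1)%N.
  apply: leq_trans (size_poly_exp_leq _ _) _; rewrite ltnS.
  rewrite -[leqRHS]mul1n leq_mul2r.
  by have := size2 e; case: size => [|[|[]]] //; rewrite orbT.
rewrite mul_polyC; apply: leq_trans (size_scale_leq _ _) _.
apply: leq_trans (size_polyMleq _ _) _.
have := sizeX (- eps) (n - p)%N; rewrite polyCN mulNr => sizev.
rewrite -subn1 leq_subLR; apply: leq_trans (leq_add (sizeX eps p) sizev) _.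
by have := ltn_ord p; lia.
Qed.

End OneDim.

(** * Functions of three indices *)

Section Coefs.
Variables (C : numClosedFieldType) (eps : C).
Hypothesis eps2 : eps ^+ 2 = -1.
Hypothesis norm_eps : `|1 - 4%:R * eps| = `|1 + 4%:R * eps|.

(** The vanishing of all coefficients of F_(z zb) + z zb F_tt
    - eps (z F_z - zb F_zb)_t, for F a polynomial in z, zb, t. *)
Definition heis_coef (F : nat -> nat -> nat -> C) : Prop := forall a b c,
  a.+1%:R * b.+1%:R * F a.+1 b.+1 c
  + (if (a, b) is (a'.+1, b'.+1) then c.+2%:R * c.+1%:R * F a' b' c.+2 else 0)
  - eps * (a%:R - b%:R) * c.+1%:R * F a b c.+1 = 0.

(** The coefficients of F = (z zb + 4 t) Q. *)
Definition w_multiple (F Q : nat -> nat -> nat -> C) : Prop := forall a b c,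
  F a b c = (if (a, b) is (a'.+1, b'.+1) then Q a' b' c else 0)
            + 4%:R * (if c is c'.+1 then Q a b c' else 0).

(** Along the line of indices (m + i, i, n - i) the equation of [heis_coef] is
    [profile_rec], and the sum over the line of F (-4)^i telescopes because
    z zb + 4 t vanishes at z zb = -4, t = 1. *)
Lemma heis_coef_zero F Q : heis_coef F -> w_multiple F Q ->
  forall m b c, F (m + b)%N b c = 0.
Proof.
move=> hF hQ m b c; pose n := (b + c)%N.
pose g i := F (m + i)%N i (n - i)%N.
suff g0 : forall i, (i <= n)%N -> g i = 0.
  by have := g0 b (leq_addr _ _); rewrite /g /n addKn.
apply: (profile_boundary_zero eps2 norm_eps (m := m)).
  move=> i ltin; rewrite /g.
  have [c' ->] : exists c', n = (i + c').+1.
    by exists (n - i.+1)%N; rewrite -addSn subnKC.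
  have := hF (m + i)%N i c'.
  rewrite subSS addKn -[(i + c').+1]addnS addKn eps2 mulN1r opprK => hF0.
  apply: etrans hF0; rewrite addnS -!natr1 !natrD -!natr1.
  case: i ltin => [|j] ltjn.
    by rewrite addn0; case: (m) => [|?]; ring.
  have -> : (j.+1 + c'.+1 - j = c'.+2)%N by lia.
  by rewrite addnS; ring.
pose sg i : C := (- 4%:R) ^+ i *
  if i is j.+1 then Q (m + j)%N j (n - j.+1)%N else 0.
transitivity (sg n + \sum_(0 <= i < n) - (sg i.+1 - sg i)).
  rewrite big_mkord big_ord_recr /= addrC; congr (_ + _).
    rewrite /g hQ subnn /sg; case: (n) => [|k]; rewrite ?addn0 /= ?addnS ?subnn.
      by case: (m) => [|?]; ring.
    by ring.
  apply: eq_bigr => -[i ltin] _ /=; rewrite /g hQ /sg.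
  have ni : (n - i = (n - i.+1).+1)%N by lia.
  case: i ltin ni => [|i] ltin ni; rewrite ?addn0 ?addnS ni !exprS.
    by case: (m) => [|?]; ring.
  by ring.
by rewrite sumrN telescope_sumr // opprB addrC subrK /sg mulr0.
Qed.

End Coefs.

(** * Substitution in multivariate polynomials *)

Section MPolyTools.
Variables (n : nat) (K : comNzRingType).

Lemma mpoly_gen_ind (P : {mpoly K[n]} -> Prop) :
    (forall c, P c%:MP) -> (forall i, P 'X_i) ->
    (forall p q, P p -> P q -> P (p + q)) ->
    (forall p q, P p -> P q -> P (p * q)) ->
  forall p, P p.
Proof.
move=> PC PX PD PM; elim/mpolyind => [|c m p _ _ Pp]; first exact: PC 0.
apply: PD Pp; rewrite -mul_mpolyC mpolyXE_id; apply: (PM _ _ (PC c)).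
have P1 : P 1 by exact: PC 1.
elim/big_rec: _ => // i q _ Pq; apply: (PM _ _ _ Pq).
by elim: (m i) => // k IH; rewrite exprS; apply: (PM) IH.
Qed.

Lemma mderiv_comp (k : nat) (lq : n.-tuple {mpoly K[k]}) (i : 'I_k) p :
  (p \mPo lq)^`M(i) = \sum_j (p^`M(j) \mPo lq) * (tnth lq j)^`M(i).
Proof.
elim/mpoly_gen_ind: p => [c|l|p q IHp IHq|p q IHp IHq].
- rewrite comp_mpolyC mderivC big1 // => j _.
  by rewrite mderivC comp_mpoly0 mul0r.
- rewrite comp_mpolyXU (bigD1 l) //= big1 => [|j jl].
    have -> : 'X_l^`M(l) = 1 :> {mpoly K[n]}.
      rewrite mderivX mnm1E eqxx scale1r -mpolyX0; congr 'X_[_].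
      by apply/mnmP => ?; rewrite !mnmE subnn.
    rewrite comp_mpoly1 mul1r addr0.
    by rewrite -tnth_nth.
  by rewrite mderivX mnm1E eq_sym (negPf jl) scale0r comp_mpoly0 mul0r.
- rewrite comp_mpolyD mderivD IHp IHq -big_split; apply: eq_bigr => j _ /=.
  by rewrite mderivD comp_mpolyD mulrDl.
rewrite rmorphM mderivM IHp IHq mulr_suml mulr_sumr -big_split.
apply: eq_bigr => j _ /=.
by rewrite mderivM comp_mpolyD !rmorphM /=; ring.
Qed.

Lemma comp_mpolyK (lq lr : n.-tuple {mpoly K[n]}) :
    (forall i, tnth lq i \mPo lr = 'X_i) ->
  forall p, (p \mPo lq) \mPo lr = p.
Proof.
move=> lqK; elim/mpoly_gen_ind => [c|i|p q IHp IHq|p q IHp IHq].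
- by rewrite !comp_mpolyC.
- by rewrite comp_mpolyXU -tnth_nth lqK.
- by rewrite !comp_mpolyD IHp IHq.
- by rewrite !rmorphM /= IHp IHq.
Qed.

Lemma mcoeff_mulXU i (p : {mpoly K[n]}) m :
  ('X_i * p)@_m = if m i == 0%N then 0 else p@_(m - U_(i)).
Proof.
rewrite mulrC; case: ifPn => [/eqP mi0|mi_neq0].
  apply: memN_msupp_eq0; rewrite (perm_mem (msuppMX p U_(i))).
  apply/mapP => -[m' _ /(congr1 (fun k : 'X_{1..n} => k i))].
  by rewrite mi0 mnmDE mnm1E eqxx.
by rewrite -[in LHS](@submK _ U_(i)%MM m) ?lep1mP // addmC mcoeffMX.
Qed.

End MPolyTools.

(** * The sub-Laplacian in complex coordinates *)

Lemma mderivXU (n : nat) (A : nzRingType) (i j : 'I_n) :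
  ('X_i : {mpoly A[n]})^`M(j) = (i == j)%:R.
Proof.
rewrite mderivX mnm1E; case: eqP => [->|_]; last by rewrite scale0r.
rewrite scale1r -mpolyX0; congr 'X_[_].
by apply/mnmP => ?; rewrite !mnmE subnn.
Qed.

Lemma ord3_ind (Q : 'I_3 -> Prop) : Q ix -> Q iy -> Q it -> forall i, Q i.
Proof.
by move=> Qx Qy Qt [[|[|[|//]]] lti];
  [move: Qx | move: Qy | move: Qt]; congr Q; apply: val_inj.
Qed.

Lemma big_ord3 (T : Type) (idx : T) (op : Monoid.law idx) (F : 'I_3 -> T) :
  \big[op/idx]_i F i = op (op (F ix) (F iy)) (F it).
Proof.
rewrite !big_ord_recr big_ord0 /= Monoid.mul1m.
by congr (op (op (F _) (F _)) (F _)); apply: val_inj.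
Qed.

(** The fields and w over an arbitrary coefficient ring: over the complex
    numbers they are convertible to [fieldX], [fieldY] and [wpoly]. *)
Section HeisenbergFields.
Variable K : comNzRingType.
Local Notation P := {mpoly K[3]}.
Local Notation x := ('X_ix : P).
Local Notation y := ('X_iy : P).
Local Notation t := ('X_it : P).

Definition heis_X (p : P) : P := p^`M(ix) + 2%:R * y * p^`M(it).
Definition heis_Y (p : P) : P := p^`M(iy) - 2%:R * x * p^`M(it).
Definition heis_lap (p : P) : P := heis_X (heis_X p) + heis_Y (heis_Y p).

Lemma heis_lapE (p : P) : heis_lap p =
  p^`M(ix)^`M(ix) + p^`M(iy)^`M(iy)
  + 4%:R * (x ^+ 2 + y ^+ 2) * p^`M(it)^`M(it)
  + 4%:R * y * p^`M(ix)^`M(it) - 4%:R * x * p^`M(iy)^`M(it).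
Proof.
rewrite /heis_lap /heis_X /heis_Y.
rewrite !(mderivD, mderivN, mderivM) -!mpolyC_nat !mderivC !mderivXU /=.
rewrite -(mderiv_comm ix it) -(mderiv_comm iy it) !mpolyC_nat.
ring.
Qed.

(** The substitution x = z + zb, y = - I (z - zb), t = 4 T, with z, zb, T
    written as the three variables. These scalings (z is half of x + I y)
    remove all constants from the operator below and keep the shape z zb + 4 T
    of w. *)
Definition complex_coords (I : K) : 3.-tuple P :=
  [tuple x + y; - I%:MP * (x - y); 4%:R * t].

Definition complex_lap (I : K) (p : P) : P :=
  p^`M(ix)^`M(iy) + x * y * p^`M(it)^`M(it)
  - I%:MP * (x * p^`M(ix)^`M(it) - y * p^`M(iy)^`M(it)).

Lemma mderiv_complex_coords (I : K) (q : P) (phi := complex_coords I) :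
  [/\ (q \mPo phi)^`M(ix) = (q^`M(ix) \mPo phi) - I%:MP * (q^`M(iy) \mPo phi),
      (q \mPo phi)^`M(iy) = (q^`M(ix) \mPo phi) + I%:MP * (q^`M(iy) \mPo phi)
    & (q \mPo phi)^`M(it) = 4%:R * (q^`M(it) \mPo phi)].
Proof.
rewrite !mderiv_comp !big_ord3 !(tnth_nth 0) /=.
rewrite !(mderivD, mderivN, mderivM) !mderivC !mderivXU /=.
by split; ring.
Qed.

Lemma heis_lap_complex (I : K) p (phi := complex_coords I) : I ^+ 2 = -1 ->
  heis_lap p \mPo phi = complex_lap I (p \mPo phi).
Proof.
move=> I2; have {}I2 : I%:MP ^+ 2 + 1 = 0 :> P.
  by rewrite -rmorphXn /= I2 rmorphN1 addNr.
rewrite heis_lapE /complex_lap.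
have [-> -> ->] := mderiv_complex_coords I p; rewrite -/phi.
have [_ xy xt] := mderiv_complex_coords I p^`M(ix).
have [_ yy yt] := mderiv_complex_coords I p^`M(iy).
have [_ _ tt] := mderiv_complex_coords I p^`M(it).
rewrite !(mderivD, mderivN, mderivM) !mderivC xy yy xt yt tt -/phi.
rewrite (mderiv_comm iy ix).
rewrite !(comp_mpolyD, comp_mpolyN, rmorphM, rmorphXn) /= !rmorph_nat.
rewrite !comp_mpolyXU /= !comp_mpolyD !rmorphXn /= !comp_mpolyXU /=.
apply/eqP; rewrite -subr_eq0; apply/eqP.
(* Both sides agree modulo I^2 + 1. *)
transitivity ((I%:MP ^+ 2 + 1) * ((p^`M(iy)^`M(iy) \mPo phi)
  + 4%:R * (x - y) ^+ 2 * (p^`M(it)^`M(it) \mPo phi)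
  - 4%:R * (x + y) * (p^`M(iy)^`M(it) \mPo phi))); last by rewrite I2 mul0r.
move: (p^`M(iy)^`M(iy) \mPo phi) (p^`M(it)^`M(it) \mPo phi)
  (p^`M(iy)^`M(it) \mPo phi) (p^`M(ix)^`M(ix) \mPo phi)
  (p^`M(ix)^`M(iy) \mPo phi) (p^`M(ix)^`M(it) \mPo phi)
  (p^`M(it) \mPo phi) (p^`M(iy) \mPo phi) => pyy ptt pyt pxx pxy pxt pt py.
ring.
Qed.

Definition heis_w : P := x ^+ 2 + y ^+ 2 + 4%:R * t.

Lemma heis_w_complex (I : K) : I ^+ 2 = -1 ->
  heis_w \mPo complex_coords I = 4%:R * (x * y + 4%:R * t).
Proof.
move=> I2; have {}I2 : I%:MP ^+ 2 + 1 = 0 :> P.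
  by rewrite -rmorphXn /= I2 rmorphN1 addNr.
have c4 : 4%:R \mPo complex_coords I = 4%:R :> P.
  by rewrite -mpolyC_nat comp_mpolyC.
rewrite /heis_w 2!comp_mpolyD !rmorphM /= c4 !comp_mpolyXU /=.
apply/eqP; rewrite -subr_eq0; apply/eqP.
transitivity ((I%:MP ^+ 2 + 1) * (x - y) ^+ 2); last by rewrite I2 mul0r.
ring.
Qed.


Definition mono a b c : 'X_{1..3} := [multinom [tuple a; b; c]].
Definition mono_coef (p : P) a b c : K := p@_(mono a b c).

Lemma monoP (m : 'X_{1..3}) : m = mono (m ix) (m iy) (m it).
Proof.
by apply/mnmP; case=> -[|[|[|//]]] lti; rewrite mnm_tnth /=;
  congr (m _); apply: val_inj.
Qed.

Lemma mono_coef0P (p : P) : (forall a b c, mono_coef p a b c = 0) -> p = 0.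
Proof.
by move=> p0; apply/mpolyP => m; rewrite mcoeff0 [m]monoP; apply: p0.
Qed.

Lemma monoE a b c :
  (mono a b c ix = a) * (mono a b c iy = b) * (mono a b c it = c).
Proof. by rewrite !mnm_tnth !(tnth_nth 0%N). Qed.

Lemma mono_addU a b c :
  ((mono a b c + U_(ix))%MM = mono a.+1 b c)
  * ((mono a b c + U_(iy))%MM = mono a b.+1 c)
  * ((mono a b c + U_(it))%MM = mono a b c.+1).
Proof.
by do !split; rewrite [LHS]monoP !mnmDE !mnm1E !monoE /= ?addn0 ?addn1.
Qed.

Lemma mono_subU a b c :
  ((mono a.+1 b c - U_(ix))%MM = mono a b c)
  * ((mono a b.+1 c - U_(iy))%MM = mono a b c)
  * ((mono a b c.+1 - U_(it))%MM = mono a b c).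
Proof.
by do !split; rewrite [LHS]monoP !mnmBE !mnm1E !monoE /= ?subn0 ?subn1.
Qed.

Lemma mono_coef_mulXY p a b c :
  mono_coef (x * y * p) a b c =
  if (a, b) is (a'.+1, b'.+1) then mono_coef p a' b' c else 0.
Proof.
rewrite /mono_coef -mulrA mcoeff_mulXU monoE; case: a => [|a] //=.
by rewrite mono_subU mcoeff_mulXU monoE; case: b => [|b] //=; rewrite mono_subU.
Qed.

Lemma mono_coef_complex_lap (I : K) p a b c :
  mono_coef (complex_lap I p) a b c =
  a.+1%:R * b.+1%:R * mono_coef p a.+1 b.+1 c
  + (if (a, b) is (a'.+1, b'.+1) then c.+2%:R * c.+1%:R * mono_coef p a' b' c.+2
     else 0)
  - I * (a%:R - b%:R) * c.+1%:R * mono_coef p a b c.+1.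
Proof.
have euler q : mono_coef (x * q^`M(ix) - y * q^`M(iy)) a b c
    = (a%:R - b%:R) * mono_coef q a b c.
  rewrite /mono_coef mcoeffB !mcoeff_mulXU !monoE mulrBl; congr (_ - _).
    case: a => [|a] /=; first by rewrite mul0r.
    by rewrite mono_subU mcoeff_deriv mono_addU monoE mulr_natl.
  case: b => [|b] /=; first by rewrite mul0r.
  by rewrite mono_subU mcoeff_deriv mono_addU monoE mulr_natl.
rewrite /complex_lap (mderiv_comm ix it) (mderiv_comm iy it).
rewrite {1}/mono_coef mcoeffB mcoeffD mcoeffCM -!/(mono_coef _ a b c) euler.
congr (_ + _ - _).
- rewrite /mono_coef !mcoeff_deriv !mono_addU !monoE -mulrnA -[LHS]mulr_natl.
  by rewrite natrM; congr (_ * _); rewrite mulrC.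
- rewrite mono_coef_mulXY; case: a b {euler} => [|a] [|b] //.
  rewrite /mono_coef !mcoeff_deriv !mono_addU !monoE -mulrnA -[LHS]mulr_natl.
  by rewrite natrM.
by rewrite /mono_coef mcoeff_deriv mono_addU monoE; ring.
Qed.

End HeisenbergFields.

(** * Injectivity *)

(** A monomial z^a zb^b T^c with a >= b lies on a line treated by
    [heis_coef_zero] for eps = i; if a < b, exchanging z and zb changes the sign
    of eps. *)
Lemma heis_lap_w_inj (K : numClosedFieldType) (q : {mpoly K[3]}) :
  heis_lap (heis_w K * q) = 0 -> q = 0.
Proof.
move=> lap0; pose phi := complex_coords ('i : K).
have i2 : 'i ^+ 2 = -1 :> K by rewrite sqrCi.
have norm_i : `|1 - 4%:R * 'i| = `|1 + 4%:R * 'i : K|.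
  have := norm_conjC (1 - 4%:R * 'i : K).
  rewrite raddfB /= rmorph1 rmorphM /= rmorph_nat conjCi => <-.
  by rewrite mulrN opprK.
have norm_Ni : `|1 - 4%:R * (- 'i)| = `|1 + 4%:R * (- 'i) : K|.
  by rewrite !mulrN opprK norm_i.
have Ni2 : (- 'i) ^+ 2 = -1 :> K by rewrite sqrrN.
have wq0 : (heis_w K * q) \mPo phi = 0.
  pose Q := 4%:R * (q \mPo phi).
  have wqE : (heis_w K * q) \mPo phi = ('X_ix * 'X_iy + 4%:R * 'X_it) * Q.
    by rewrite rmorphM /= heis_w_complex // /Q; ring.
  have heis : heis_coef 'i (mono_coef ((heis_w K * q) \mPo phi)).
    move=> a b c; rewrite -mono_coef_complex_lap -heis_lap_complex // lap0.
    by rewrite comp_mpoly0 /mono_coef mcoeff0.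
  have wmul : w_multiple (mono_coef ((heis_w K * q) \mPo phi)) (mono_coef Q).
    move=> a b c; rewrite wqE mulrDl {1}/mono_coef mcoeffD.
    rewrite -!/(mono_coef _ a b c) mono_coef_mulXY; congr (_ + _).
    rewrite -mulrA -mpolyC_nat /mono_coef mcoeffCM mcoeff_mulXU monoE.
    by case: c => [|c] //=; rewrite mono_subU.
  apply: mono_coef0P => a b c; case: (leqP b a) => [leba|/ltnW leab].
    by rewrite -(subnK leba) (heis_coef_zero i2 norm_i heis wmul).
  have heis' : heis_coef (- 'i)
      (fun a b => mono_coef ((heis_w K * q) \mPo phi) b a).
    move=> a' b' c'; apply: etrans (heis b' a' c').
    by case: a' b' => [|a'] [|b']; ring.
  have wmul' : w_multiple (fun a b => mono_coef ((heis_w K * q) \mPo phi) b a)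
     (fun a b => mono_coef Q b a).
    by move=> a' b' c'; rewrite wmul; case: a' b' => [|a'] [|b'].
  by rewrite -(subnK leab); apply: (heis_coef_zero Ni2 norm_Ni heis' wmul').
(* psi is the inverse substitution, so w q itself is zero. *)
have half : 2%:R != 0 :> K by rewrite pnatr_eq0.
pose psi : 3.-tuple {mpoly K[3]} := [tuple
   (2%:R^-1)%:MP * ('X_ix + 'i%:MP * 'X_iy);
   (2%:R^-1)%:MP * ('X_ix - 'i%:MP * 'X_iy);
   (4%:R^-1)%:MP * 'X_it].
have phiK p : (p \mPo phi) \mPo psi = p.
  have cC (c : K) : c%:MP \mPo psi = c%:MP by exact: comp_mpolyC.
  have half2 : (2%:R^-1)%:MP * 2%:R = 1 :> {mpoly K[3]}.
    by rewrite -mpolyC_nat -mpolyCM mulVf.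
  have quarter4 : (4%:R^-1)%:MP * 4%:R = 1 :> {mpoly K[3]}.
    by rewrite -mpolyC_nat -mpolyCM mulVf // pnatr_eq0.
  have i2' : 'i%:MP ^+ 2 = -1 :> {mpoly K[3]}.
    by rewrite -rmorphXn /= i2 rmorphN1.
  apply: comp_mpolyK; apply: ord3_ind; rewrite (tnth_nth 0) /=.
  - rewrite comp_mpolyD !comp_mpolyXU /=.
    transitivity ('X_ix * ((2%:R^-1)%:MP * 2%:R) : {mpoly K[3]}); first by ring.
    by rewrite half2 mulr1.
  - rewrite rmorphM rmorphB rmorphN /= cC !comp_mpolyXU /=.
    transitivity
      (- 'i%:MP ^+ 2 * 'X_iy * ((2%:R^-1)%:MP * 2%:R) : {mpoly K[3]}).
      by ring.
    by rewrite half2 i2' opprK mul1r mulr1.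
  rewrite rmorphM /= -mpolyC_nat cC !comp_mpolyXU /= mpolyC_nat.
  transitivity ('X_it * ((4%:R^-1)%:MP * 4%:R) : {mpoly K[3]}); first by ring.
  by rewrite quarter4 mulr1.
have := phiK (heis_w K * q); rewrite wq0 comp_mpoly0 => /esym/eqP.
rewrite mulf_eq0 => /orP[/eqP w0|/eqP //].
have := congr1 (meval (fun=> 1)) w0.
rewrite /heis_w -mpolyC_nat 2!mevalD !rmorphM /= mevalC !mevalXU meval0 !mulr1.
have -> : 1 + 1 + 4%:R = 6%:R :> K by ring.
by move/eqP; rewrite pnatr_eq0.
Qed.

(** * Injective endomorphisms of finite-dimensional spaces *)

Section FiniteDim.
Variables (K : fieldType) (V : lmodType K) (f : {linear V -> V}).
Hypothesis f_inj : injective f.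

(** If c_k is the first nonzero coefficient, injectivity cancels f^k from the
    relation, and what remains expresses v as an image. *)
Lemma orbit_relation_preim (v : V) n (c : nat -> K) :
    \sum_(i < n) c i *: iter i f v = 0 ->
  (exists2 i, (i < n)%N & c i != 0) -> exists u, f u = v.
Proof.
elim: n c => [|n IH] c; first by move=> _ [].
rewrite big_ord_recl /= => rel [k ltkn ck].
pose s := \sum_(i < n) c i.+1 *: iter i f v.
have {}rel : c 0%N *: v + f s = 0.
  rewrite linear_sum -[RHS]rel; congr (_ + _).
  by apply: eq_bigr => i _; rewrite linearZ.
have [c0|c0] := eqVneq (c 0%N) 0.
  apply: (IH (fun i => c i.+1)).
    by apply: f_inj; rewrite linear0 -[RHS]rel c0 scale0r add0r.
  by case: k ltkn ck => [|k] ltkn; rewrite ?c0 ?eqxx // => ck; exists k.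
exists (- (c 0%N)^-1 *: s); rewrite linearZ /=.
have -> : f s = - (c 0%N *: v) by apply/eqP; rewrite -addr_eq0 addrC rel.
by rewrite scalerN scaleNr opprK scalerA mulVf // scale1r.
Qed.

(** An embedding into row vectors of length N makes v, f v, ..., f^N v linearly
    dependent. *)
Lemma inj_endo_surj (N : nat) (h : {linear V -> 'rV[K]_N}) :
  injective h -> forall v, exists u, f u = v.
Proof.
move=> h_inj v; pose M := \matrix_(i < N.+1) h (iter i f v).
have : kermx M != 0.
  rewrite kermx_eq0 /row_free neq_ltn (leq_ltn_trans (rank_leq_col M)) //.
case/rowV0Pn => c /sub_kermxP cM c_neq0.
pose d i := c 0 (inord i).
apply: (@orbit_relation_preim v N.+1 d).
  apply: h_inj; rewrite linear0 linear_sum -[RHS]cM mulmx_sum_row.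
  by apply: eq_bigr => i _; rewrite linearZ /d inord_val rowK.
have /rV0Pn [i ci] := c_neq0.
by exists i => //; rewrite /d inord_val.
Qed.

End FiniteDim.

(** * Dilations and homogeneity *)

Section Dilation.
Variable K : comNzRingType.
Local Notation P := {mpoly K[3]}.

Definition dil (c : K) : 3.-tuple P :=
  [tuple c *: 'X_ix; c *: 'X_iy; c ^+ 2 *: 'X_it].

Lemma mderiv_dil c (p : P) :
  [/\ (p \mPo dil c)^`M(ix) = c%:MP * (p^`M(ix) \mPo dil c),
      (p \mPo dil c)^`M(iy) = c%:MP * (p^`M(iy) \mPo dil c)
    & (p \mPo dil c)^`M(it) = c%:MP ^+ 2 * (p^`M(it) \mPo dil c)].
Proof.
rewrite !mderiv_comp !big_ord3 !(tnth_nth 0) /= -!mul_mpolyC.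
rewrite !(mderivM, mderivC) !mderivXU /= !rmorphXn /=.
by split; ring.
Qed.

Lemma heis_X_dil c (p : P) :
  heis_X (p \mPo dil c) = c%:MP * (heis_X p \mPo dil c).
Proof.
have c2 : 2%:R \mPo dil c = 2%:R :> P by rewrite -mpolyC_nat comp_mpolyC.
rewrite /heis_X; have [-> _ ->] := mderiv_dil c p.
rewrite comp_mpolyD !rmorphM /= c2 !comp_mpolyXU /= -!mul_mpolyC; ring.
Qed.

Lemma heis_Y_dil c (p : P) :
  heis_Y (p \mPo dil c) = c%:MP * (heis_Y p \mPo dil c).
Proof.
have c2 : 2%:R \mPo dil c = 2%:R :> P by rewrite -mpolyC_nat comp_mpolyC.
rewrite /heis_Y; have [_ -> ->] := mderiv_dil c p.
rewrite comp_mpolyB !rmorphM /= c2 !comp_mpolyXU /= -!mul_mpolyC; ring.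
Qed.

Lemma heis_lap_dil c (p : P) :
  heis_lap (p \mPo dil c) = c ^+ 2 *: (heis_lap p \mPo dil c).
Proof.
have XC a (q : P) : heis_X (a%:MP * q) = a%:MP * heis_X q.
  by rewrite /heis_X !mderivM !mderivC; ring.
have YC a (q : P) : heis_Y (a%:MP * q) = a%:MP * heis_Y q.
  by rewrite /heis_Y !mderivM !mderivC; ring.
rewrite /heis_lap !heis_X_dil !heis_Y_dil XC YC heis_X_dil heis_Y_dil.
rewrite comp_mpolyD.
rewrite -mul_mpolyC rmorphXn /=; ring.
Qed.

Lemma heis_lap_is_linear a (p q : P) :
  heis_lap (a *: p + q) = a *: heis_lap p + heis_lap q.
Proof. by rewrite !heis_lapE !mderivD !mderivZ -!mul_mpolyC; ring. Qed.

HB.instance Definition _ :=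
  GRing.isLinear.Build K P P _ (@heis_lap K) heis_lap_is_linear.

Lemma heis_w_dil c : heis_w K \mPo dil c = c ^+ 2 *: heis_w K.
Proof.
have c4 : 4%:R \mPo dil c = 4%:R :> P by rewrite -mpolyC_nat comp_mpolyC.
rewrite /heis_w 2!comp_mpolyD !rmorphM /= c4 !comp_mpolyXU /= -!mul_mpolyC.
rewrite rmorphXn /=; ring.
Qed.

Lemma mcoeff_dil c (p : P) m :
  (p \mPo dil c)@_m = c ^+ (m ix + m iy + 2 * m it) * p@_m.
Proof.
elim/mpolyind: p => [|a k p _ _ IH]; first by rewrite comp_mpoly0 mcoeff0 mulr0.
rewrite comp_mpolyD comp_mpolyZ !mcoeffD !mcoeffZ IH mulrDr; congr (_ + _).
rewrite mulrCA; congr (_ * _).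
have -> : 'X_[k] \mPo dil c = c ^+ (k ix + k iy + 2 * k it) *: 'X_[k].
  rewrite comp_mpolyX mpolyXE_id !big_ord3 /= !(tnth_nth 0) /= !exprZn.
  by rewrite -!mul_mpolyC -exprM !exprD !mpolyCM; ring.
rewrite mcoeffZ mcoeffX; case: eqP => [->|]; by rewrite ?mulr0.
Qed.

End Dilation.

Lemma heis_lap_w_homog (K : fieldType) (c d : K) (q : {mpoly K[3]}) :
  c != 0 -> q \mPo dil c = d *: q ->
  heis_lap (heis_w K * q) \mPo dil c = d *: heis_lap (heis_w K * q).
Proof.
move=> c_neq0 hq; apply: (scalerI (expf_neq0 2 c_neq0)).
rewrite -heis_lap_dil rmorphM /= hq heis_w_dil -scalerAl -scalerAr.
have lapZ a p : heis_lap (a *: p) = a *: heis_lap p by exact: linearZ.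
by rewrite !lapZ.
Qed.

(** * The automorphism of the space of homogeneous polynomials *)

Section Main.
Variables (R : realType) (j : nat).
Local Notation K := R[i].
Local Notation H := (hhomog R j).

Lemma dilation_dil (r : R) : dilation r = dil (r%:C)%C.
Proof. by rewrite /dilation rmorphXn. Qed.

Lemma hhomog_lap_w (q : H) :
  sub_laplacian (wpoly R * hhomog_val q) \in @hhomog_pred R j.
Proof.
case: q => q /asboolP hq /=; apply/asboolP => r r_gt0.
have c_neq0 : (r%:C)%C != 0 :> K by rewrite fmorph_eq0 gt_eqF.
have := hq r r_gt0; rewrite dilation_dil => hqr.
exact: heis_lap_w_homog hqr.
Qed.

(** Homogeneity for the single dilation of ratio 2 already fixes the weighted
    degree of every monomial, since 2^k = 2^j forces k = j. *)
Lemma hhomog_coef0 (q : H) (m : 'X_{1..3}) : (m ix + m iy + 2 * m it)%N != j ->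
  (hhomog_val q)@_m = 0.
Proof.
case: q => q /asboolP hq /= wtm; have := hq 2%:R (ltr0n _ 2).
rewrite dilation_dil rmorphXn /= rmorph_nat => /(congr1 (mcoeff m)).
rewrite mcoeff_dil mcoeffZ => /eqP; rewrite -subr_eq0 -mulrBl mulf_eq0.
by rewrite subr_eq0 -!natrX eqr_nat eqn_exp2l // (negPf wtm) => /eqP.
Qed.

Definition lap_w (q : H) : H := HHomog (hhomog_lap_w q).

Lemma lap_w_is_linear : linear lap_w.
Proof.
move=> a p q; apply: val_inj => /=.
by rewrite mulrDr -scalerAr; apply: heis_lap_is_linear.
Qed.

HB.instance Definition _ := GRing.isLinear.Build K H H _ lap_w lap_w_is_linear.

Lemma lap_w_inj : injective lap_w.
Proof.
move=> p q /eqP; rewrite -subr_eq0 -linearB => /eqP /(congr1 (@hhomog_val R j)).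
by move=> /= /heis_lap_w_inj /eqP; rewrite subr_eq0 => /eqP /val_inj.
Qed.

Local Notation box := ('I_j.+1 * 'I_j.+1 * 'I_j.+1)%type.

(** A monomial of weighted degree j has all its exponents at most j, so these
    coefficients determine an element of the space. *)
Definition coef_row (q : H) : 'rV[K]_#|{: box}| :=
  \row_k (let e : box := enum_val k in (hhomog_val q)@_(mono e.1.1 e.1.2 e.2)).

Lemma coef_row_is_linear : linear coef_row.
Proof. by move=> a p q; apply/rowP => k; rewrite !mxE -mcoeffZ -mcoeffD. Qed.

HB.instance Definition _ :=
  GRing.isLinear.Build K H _ _ coef_row coef_row_is_linear.

Lemma coef_row_inj : injective coef_row.
Proof.
move=> p q /rowP pq; apply/val_inj/mpolyP => m /=.
have [wtm|wtm] := eqVneq (m ix + m iy + 2 * m it)%N j; last first.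
  by rewrite !hhomog_coef0.
have lex : (m ix < j.+1)%N by lia.
have ley : (m iy < j.+1)%N by lia.
have le_t : (m it < j.+1)%N by lia.
have := pq (enum_rank ((Ordinal lex, Ordinal ley, Ordinal le_t) : box)).
by rewrite !mxE enum_rankK /= -monoP.
Qed.

End Main.

Theorem lemma6p1 (R : realType) (j : nat) :
  exists A : {linear hhomog R j -> hhomog R j},
    (forall q : hhomog R j, hhomog_val (A q) = sub_laplacian (wpoly R * hhomog_val q)) /\
    bijective A.
Proof.
exists (@lap_w R j); split=> //.
have [g gK] := choice (inj_endo_surj (@lap_w_inj R j) (@coef_row_inj R j)).
by exists g => // q; apply: lap_w_inj; rewrite gK.
Qed.
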